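(* Let $n\ge 5$ be an odd integer and let $M$ be a perfect matching of the flower snark $\mathcal{F}_n$. Then $\mathcal{F}_n+M$ is Class I.
   Context: For odd $n\ge 3$, the flower snark $\mathcal{F}_n$ is the cubic graph on the $4n$ vertices $a_i,b_i,c_i,d_i$ ($i\in\mathbb{Z}/n\mathbb{Z}$) with edges $a_ib_i,\ a_ic_i,\ a_id_i$ (a star centred at $a_i$) and $b_ib_{i+1},\ c_id_{i+1},\ d_ic_{i+1}$ for every $i\in\mathbb{Z}/n\mathbb{Z}$. For a perfect matching $M$ of a graph $G$, $G+M$ denotes the multigraph obtained from $G$ by adding one parallel edge to every edge in $M$. A multigraph is Class I if its chromatic index equals its maximum degree (so for $\mathcal{F}_n+M$ this means it is properly $4$-edge-colourable). *)

(* Defs.v *)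
From HB Require Import structures.
From mathcomp Require Import all_boot all_order all_algebra.
Set Implicit Arguments.
Unset Strict Implicit.
Unset Printing Implicit Defensive.

Import GRing.Theory.

(* Finite loopless multigraphs: parallel edges are distinct elements of
   [edge] with the same pair of ends. *)
Record multigraph := Multigraph {
  vertex : finType;
  edge : finType;
  ends : edge -> {set vertex};
  card_ends : forall e, #|ends e| = 2
}.

Definition degree (G : multigraph) (v : vertex G) : nat :=
  #|[set e : edge G | v \in ends e]|.

Definition max_degree (G : multigraph) : nat :=
  \max_(v : vertex G) degree v.

Definition proper_edge_coloring (G : multigraph) (k : nat)
    (c : {ffun edge G -> 'I_k}) : bool :=
  [forall e, forall f,
     (e != f) && (ends e :&: ends f != set0) ==> (c e != c f)].

Definition edge_colorable (G : multigraph) (k : nat) : bool :=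
  [exists c : {ffun edge G -> 'I_k}, proper_edge_coloring c].

Lemma edge_colorable_ex (G : multigraph) : exists k, edge_colorable G k.
Proof.
exists #|edge G|; apply/existsP; exists [ffun e => enum_rank e].
apply/forallP => e; apply/forallP => f; apply/implyP => /andP[ef _].
by rewrite !ffunE (inj_eq enum_rank_inj).
Qed.

Definition chromatic_index (G : multigraph) : nat :=
  ex_minn (edge_colorable_ex G).

Definition classI (G : multigraph) : Prop :=
  chromatic_index G = max_degree G.

Definition perfect_matching (G : multigraph) (M : {set edge G}) : Prop :=
  forall v : vertex G, #|[set e in M | v \in ends e]| = 1.

Section AddParallel.
Variables (G : multigraph) (M : {set edge G}).

Definition add_parallel_ends (e : edge G + {e : edge G | e \in M}) :
    {set vertex G} :=
  match e with inl e => ends e | inr e => ends (val e) end.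

Lemma card_add_parallel_ends e : #|add_parallel_ends e| = 2.
Proof. by case: e => e; apply: card_ends. Qed.

(* G + M *)
Definition add_parallel : multigraph := Multigraph card_add_parallel_ends.
End AddParallel.

Section SimpleGraph.
Variables (V : finType) (r : rel V).

Definition edge_set : {set {set V}} :=
  [set [set p.1; p.2] | p : V * V & r p.1 p.2].

Hypothesis r_irr : irreflexive r.

Lemma card_edge_set (e : {e : {set V} | e \in edge_set}) : #|val e| = 2.
Proof.
case: e => e /= /imsetP[[x y]]; rewrite inE /= => rxy ->.
by rewrite cards2; case: eqVneq rxy => // ->; rewrite r_irr.
Qed.

(* The simple graph on V whose edges are the {x, y} with r x y; the relation r
   need not be symmetric, and each unordered pair occurs only once. *)
Definition simple_graph : multigraph := Multigraph card_edge_set.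
End SimpleGraph.

Variant flower_letter := La | Lb | Lc | Ld.

Definition bools_of_letter (l : flower_letter) : bool * bool :=
  match l with
  | La => (false, false) | Lb => (false, true)
  | Lc => (true, false) | Ld => (true, true)
  end.

Definition letter_of_bools (p : bool * bool) : flower_letter :=
  match p with
  | (false, false) => La | (false, true) => Lb
  | (true, false) => Lc | (true, true) => Ld
  end.

Lemma bools_of_letterK : cancel bools_of_letter letter_of_bools.
Proof. by case. Qed.

HB.instance Definition _ := Finite.copy flower_letter (can_type bools_of_letterK).

(* (La, i), (Lb, i), (Lc, i), (Ld, i) are the vertices a_i, b_i, c_i, d_i.
   'Z_n is Z/nZ for n > 1 only. *)
Definition flower_vertex (n : nat) : finType := (flower_letter * 'Z_n)%type.

Definition flower_rel (n : nat) : rel (flower_vertex n) := fun u v =>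
  match u, v with
  | (La, i), (Lb, j) | (La, i), (Lc, j) | (La, i), (Ld, j) => j == i
  | (Lb, i), (Lb, j) | (Lc, i), (Ld, j) | (Ld, i), (Lc, j) => j == (i + 1)%R
  | _, _ => false
  end.

Lemma flower_rel_irr (n : nat) : irreflexive (@flower_rel n).
Proof.
case=> [[] i] //=; apply/negbTE.
by rewrite -{1}[i]addr0 (inj_eq (addrI i)) eq_sym oner_eq0.
Qed.

Definition flower_snark (n : nat) : multigraph :=
  simple_graph (@flower_rel_irr n).

(* Main.v *)
(* Colour every edge outside M with one colour and every edge of M with a pair of
   colours.  Counting M-edges at the stars shows
   that consecutive numbers of M-links (edges joining two consecutive stars) add
   up to 2; as n is odd, each is 1.  So the four colours at each passage between
   stars form a permutation: two on the M-link, one on each other link.  From a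
   given permutation a star allows at least three continuations, and after five
   stars every permutation is reachable, whichever way M runs.  Hence for n >= 5
   the colouring can be continued around the snark so that it closes up. *)
Require Import Defs.
From mathcomp Require Import all_boot all_order all_algebra zify.
Set Implicit Arguments.
Unset Strict Implicit.
Unset Printing Implicit Defensive.

Import GRing.Theory.

(** * Degrees and chromatic index of G + M *)

Section Multigraphs.
Variable G : multigraph.
Implicit Type M : {set edge G}.

Lemma max_degree_le_colors k : edge_colorable G k -> max_degree G <= k.
Proof.
case/existsP=> c /forallP cP; apply/bigmax_leqP => v _.
rewrite /degree -[leqRHS](card_ord k) -(card_in_imset (f := c)) ?max_card //.
move=> e f; rewrite !inE => ve vf cef; apply/eqP/negPn/negP => ef.
have /forallP/(_ f)/implyP := cP e; rewrite ef cef eqxx /= => H.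
by have: false by apply: H; apply/set0Pn; exists v; rewrite inE ve.
Qed.

(** The chromatic index is at most [k], the maximum degree is at least [k], and the index is never
    below the maximum degree. *)
Lemma classI_of_colorable k (v : vertex G) :
  edge_colorable G k -> k <= degree v -> classI G.
Proof.
move=> Gk kv; rewrite /classI /chromatic_index; case: ex_minnP => m Gm m_min.
apply/eqP; rewrite eqn_leq max_degree_le_colors // andbT.
by rewrite (leq_trans (m_min _ Gk)) // (leq_trans kv) // leq_bigmax.
Qed.

Lemma degree_add_parallel M (v : vertex G) : perfect_matching M ->
  degree (G := add_parallel M) v = (degree v).+1.
Proof.
move=> /(_ v) Mv; rewrite /degree -addn1 !cardsE -Mv.
pose A := [pred e : edge G | v \in ends e].
pose B := [pred e : {e : edge G | e \in M} | v \in ends (val e)].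
have -> : #|[pred e : edge (add_parallel M) | v \in ends e]| = #|A| + #|B|.
  rewrite -!sum1_card big_sumType /=; congr (_ + _); exact: eq_bigl.
congr (_ + _); rewrite -(card_imset B val_inj); apply: eq_card => e.
rewrite !inE; apply/imsetP/andP => [[x]|[eM ve]].
  by rewrite inE => ? ->; split=> //; apply: valP.
by exists (Sub e eM).
Qed.

(** Turns incidence counts into sums of bits over an explicit list of edges. *)
Lemma card_incident (A : pred (edge G)) v s : uniq s ->
  (forall e, (v \in ends e) = (e \in s)) ->
  #|[set e in A | v \in ends e]| = count A s.
Proof.
move=> s_uniq vs; rewrite -size_filter -(card_uniqP (filter_uniq _ s_uniq)).
by apply: eq_card => e; rewrite inE mem_filter vs.
Qed.

Lemma degreeE (v : vertex G) s : uniq s ->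
  (forall e, (v \in ends e) = (e \in s)) -> degree v = size s.
Proof.
move=> s_uniq vs; rewrite -(count_predT s) -(card_incident _ s_uniq vs).
by apply: eq_card => e; rewrite !inE.
Qed.

End Multigraphs.

(** * Colourings by pairs of colours *)

Section PairColoring.
Variable C : eqType.

Definition distinct (P : C * C) : bool := P.1 != P.2.

Definition disjoint_pairs (P Q : C * C) : bool :=
  [&& P.1 != Q.1, P.1 != Q.2, P.2 != Q.1 & P.2 != Q.2].

Lemma disjoint_pairsC P Q : disjoint_pairs P Q = disjoint_pairs Q P.
Proof.
rewrite /disjoint_pairs ![Q.1 == _]eq_sym ![Q.2 == _]eq_sym.
by do !bool_congr.
Qed.

End PairColoring.

(* [P e] lists the colours of [e] and of its parallel copy; the second entry is
   unused when [e \notin M]. *)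
Lemma add_parallel_colorable (G : multigraph) (M : {set edge G}) k
    (P : edge G -> 'I_k * 'I_k) :
  (forall e, e \in M -> distinct (P e)) ->
  (forall e f, e != f -> ends e :&: ends f != set0 ->
     disjoint_pairs (P e) (P f)) ->
  edge_colorable (add_parallel M) k.
Proof.
move=> PM Padj.
pose c (x : edge (add_parallel M)) : 'I_k :=
  match x with inl e => (P e).1 | inr e => (P (val e)).2 end.
apply/existsP; exists [ffun x => c x].
apply/forallP => x; apply/forallP => y; apply/implyP => /andP[xy].
rewrite !ffunE.
case: x y xy => [e|e] [f|f] /= xy xyI.
- by have /and4P[] := Padj _ _ xy xyI.
- have [->|ef] := eqVneq e (val f); first exact/PM/valP.
  by have /and4P[] := Padj _ _ ef xyI.
- have [<-|ef] := eqVneq (val e) f; first by rewrite eq_sym; exact/PM/valP.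
  by have /and4P[] := Padj _ _ ef xyI.
- by have /and4P[] := Padj _ _ xy xyI.
Qed.

(* The tracks b, c, d are [None], [Some false], [Some true]. *)
Notation track := (option bool).

(* The link leaving a star on track [t] enters the next one on [twist t]. *)
Definition twist (t : track) : track := omap negb t.

Lemma twistK : involutive twist. Proof. by case=> [[]|]. Qed.

(** * Extending a colouring across one star *)

Section Stars.
Variable C : eqType.
Implicit Types (q : C * C * C * C) (L S K : track -> C * C).

Definition all_distinct q : bool :=
  let: (p, p', r, s) := q in uniq [:: p; p'; r; s].

Definition place (T : Type) (x y : track) (P Q R : T) (t : track) : T :=
  if t == x then P else if t == y then Q else R.

(* The four colours on the left links of a star whose left matching link is on
   track [x] and whose right matching link is on track [y]. *)
Definition link_pairs (x y : track) q : track -> C * C :=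
  let: (p, p', r, s) := q in place x y (p, p') (r, r) (s, s).

(* [L], [S], [K] are the colours of the left links, spokes and right links. *)
Record star_coloring (x y : track) L S K : Prop := StarColoring {
  star_center t t' : t != t' -> disjoint_pairs (S t) (S t');
  star_left t : disjoint_pairs (L t) (S t);
  star_right t : disjoint_pairs (S t) (K t);
  star_through t : disjoint_pairs (L t) (K t);
  star_match t : t != x -> t != y -> distinct (S t);
  star_link : distinct (K y)
}.

(* Some colours possible after a star: the pair on the right matching link, then
   the colours on the tracks of the left matching link and of the matched spoke.
   The last two are exchanged unless [b], which says that the next star matches
   right along the (twisted) track of the present left matching link. *)
Definition moves (b : bool) q : seq (C * C * C * C) :=
  let: (p, p', r, s) := q in
  [seq if b then q' else (let: (u, u', v, w) := q' in (u, u', w, v))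
  | q' <- [:: (p', s, r, p); (p, s, r, p'); (p, p', s, r)]].

Lemma all_distinct_moves b q q' :
  q' \in moves b q -> all_distinct q -> all_distinct q'.
Proof.
case: q => [[[p p'] r] s]; rewrite /moves /= !inE.
case: b => /or3P[] /eqP-> /=; rewrite !inE !negb_or;
  by case/and4P=> /and3P[pp' pr ps] /andP[p'r p's] rs _;
  rewrite ?(eq_sym p' p) ?(eq_sym r) ?(eq_sym s p) ?(eq_sym s p')
    pp' pr ps p'r p's ?rs // eq_sym rs.
Qed.

(** The conditions [y != x] and [z != twist y] say that no leaf meets two matching links. *)
Lemma star_extension x y z q q' : all_distinct q -> y != x -> z != twist y ->
  q' \in moves (z == twist x) q ->
  exists S, star_coloring x y (link_pairs x y q) S
    (fun t => link_pairs (twist y) z q' (twist t)).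
Proof.
case: q => [[[p p'] r] s] /=; rewrite !inE !negb_or.
case/and4P=> /and3P[pp' pr ps] /andP[p'r p's] rs _ yx zy.
have sym := (eq_sym p' p, eq_sym r p, eq_sym s p, eq_sym r p', eq_sym s p',
  eq_sym s r).
have nz := (negbTE pp', negbTE pr, negbTE ps, negbTE p'r, negbTE p's,
  negbTE rs).
move=> q'P.
suff [S] : exists S, star_coloring x y (place x y (p, p') (r, r) (s, s)) S
  (fun t => link_pairs (twist y) z q' (twist t)) by exists S.
(* All four colours occur at each leaf, so a spoke gets what the two links on its track leave over:
   two colours if it is matched, one otherwise. *)
case/or3P: q'P => /eqP->;
  [exists (place x y (s, s) (p, p) (r, p'))
  |exists (place x y (s, s) (p', p') (r, p))
  |exists (place x y (r, r) (s, s) (p, p'))].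
all: by split; move: x y z yx zy => [[]|] [[]|] [[]|] //= _ _;
  do ?[case=> [[]|] //=]; rewrite /disjoint_pairs /distinct /= ?sym ?nz.
Qed.

End Stars.

(** * Renaming the colours *)

Definition recolor (C D : Type) (g : C -> D) (q : C * C * C * C) :
    D * D * D * D :=
  let: (p, p', r, s) := q in (g p, g p', g r, g s).

Lemma recolorK (C D : Type) (g : C -> D) h : cancel g h ->
  cancel (recolor g) (recolor h).
Proof. by move=> gK [[[p p'] r] s] /=; rewrite !gK. Qed.

Lemma all_distinct_recolor (C D : eqType) (g : C -> D) q : injective g ->
  all_distinct (recolor g q) = all_distinct q.
Proof.
by move=> g_inj; case: q => [[[p p'] r] s]; rewrite /= !inE !(inj_eq g_inj).
Qed.

(** Moves only shuffle positions, so walks can be renamed and one starting state suffices. *)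
Lemma moves_recolor (C D : eqType) (g : C -> D) b q :
  moves b (recolor g q) = map (recolor g) (moves b q).
Proof. by case: q b => [[[p p'] r] s] []. Qed.

(** * Mixing of the states in five steps *)

Section Mixing.

Local Notation color := 'I_4.
Local Notation state := (color * color * color * color)%type.
Implicit Types q : state.

(** Explicit ordinals let [reach5] be settled by computation. *)
Definition colors : seq color :=
  [:: @Ordinal 4 0 isT; @Ordinal 4 1 isT; @Ordinal 4 2 isT; @Ordinal 4 3 isT].

Definition state0 : state :=
  (@Ordinal 4 0 isT, @Ordinal 4 1 isT, @Ordinal 4 2 isT, @Ordinal 4 3 isT).

(** Four distinct colours out of four form a permutation, so renaming acts transitively on the
    states. *)
Lemma recolor_state0 q : all_distinct q ->
  exists2 g : color -> color, bijective g & q = recolor g state0.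
Proof.
case: q => [[[p p'] r] s] q_uniq; exists (nth p [:: p; p'; r; s]) => //.
by apply: injF_bij => i j /eqP; rewrite nth_uniq // => /eqP/val_inj.
Qed.

Definition states : seq state :=
  [seq q <- [seq (u, w) | u <- [seq (u, r) | u <-
    [seq (p, p') | p <- colors, p' <- colors], r <- colors], w <- colors]
  | all_distinct q].

Lemma mem_colors (c : color) : c \in colors.
Proof. by case: c => [[|[|[|[|]]]]]. Qed.

Lemma mem_states q : all_distinct q -> q \in states.
Proof.
move=> qP; rewrite mem_filter qP; case: q {qP} => [[[p p'] r] s].
by do 3![apply: (allpairs_f pair); last exact: mem_colors]; apply: mem_colors.
Qed.

Fixpoint reach (w : bitseq) (qs : seq state) : seq state :=
  if w is b :: w' then reach w' (undup (flatten [seq moves b q | q <- qs]))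
  else qs.

Definition walk (b : nat -> bool) m q q' : Prop :=
  exists f : nat -> state, [/\ f 0 = q, f m = q' &
    forall i, i < m -> f i.+1 \in moves (b i) (f i)].

Lemma walkS b m q q1 q' : q1 \in moves (b 0) q ->
  walk (b \o succn) m q1 q' -> walk b m.+1 q q'.
Proof.
move=> q1P [f [f0 fm fS]]; exists (fun i => if i is j.+1 then f j else q).
by split=> // -[|i]; [rewrite f0 | apply: fS].
Qed.

Lemma reach_walk b m qs q' : q' \in reach (mkseq b m) qs ->
  exists2 q, q \in qs & walk b m q q'.
Proof.
elim: m b qs => [|m IHm] b qs; first by exists q' => //; exists (fun=> q').
rewrite /mkseq /= -[1]/(1 + 0) iotaDl -map_comp => /IHm[q1].
rewrite mem_undup => /flatten_mapP[q qP q1P] q1w.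
by exists q => //; apply: walkS q1w.
Qed.

Lemma walk_recolor g b m q q' :
  walk b m q q' -> walk b m (recolor g q) (recolor g q').
Proof.
case=> f [f0 fm fS]; exists (recolor g \o f); rewrite /= f0 fm; split=> // i im.
by rewrite moves_recolor; apply/map_f/fS.
Qed.

(* Four stars do not suffice for these moves; this is where [5 <= n] is needed. *)
Lemma reach5 b0 b1 b2 b3 b4 :
  all (mem (reach [:: b0; b1; b2; b3; b4] [:: state0])) states.
Proof. by case: b0 b1 b2 b3 b4 => [] [] [] [] []; vm_compute. Qed.

Lemma walk_exists m b q q' :
  5 <= m -> all_distinct q -> all_distinct q' -> walk b m q q'.
Proof.
elim: m b q => // m IHm b q; rewrite leq_eqVlt => /predU1P[<-|m5] qP q'P.
  (* Rename so that the walk starts at [state0]; the target is renamed back by [h]. *)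
  have [g [h gK hK] ->] := recolor_state0 qP.
  rewrite -(recolorK hK q'); apply: walk_recolor.
  have tP : all_distinct (recolor h q').
    by rewrite all_distinct_recolor //; apply: can_inj hK.
  have /allP/(_ _ (mem_states tP)) := reach5 (b 0) (b 1) (b 2) (b 3) (b 4).
  by move/(@reach_walk b 5) => [q1]; rewrite inE => /eqP->.
(* With more than five steps to go, the first move is arbitrary. *)
have [q1 q1P] : exists q1, q1 \in moves (b 0) q.
  by case: q {qP} => [[[p p'] r] s]; case: (b 0); eexists; apply: mem_head.
by apply: (walkS q1P); apply: IHm => //; apply: (all_distinct_moves q1P).
Qed.

End Mixing.

Definition letter (t : track) : flower_letter :=
  match t with None => Lb | Some false => Lc | Some true => Ld end.

Lemma letter_inj : injective letter. Proof. by move=> [[]|] [[]|]. Qed.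

(** * Edges of the flower snark at each vertex *)

Section FlowerSnark.
Variable n : nat.
Implicit Types (i j : 'Z_n) (t u : track) (e : edge (flower_snark n)).
Local Notation F := (flower_snark n).

Definition spoke_ends i t : {set flower_vertex n} :=
  [set (La, i); (letter t, i)].

Definition link_ends i t : {set flower_vertex n} :=
  [set (letter t, i); (letter (twist t), (i + 1)%R)].

Lemma spoke_ends_edge i t : spoke_ends i t \in edge_set (@flower_rel n).
Proof.
apply/imsetP; exists ((La, i), (letter t, i)) => //.
by rewrite inE; case: t => [[]|] /=; rewrite eqxx.
Qed.

Lemma link_ends_edge i t : link_ends i t \in edge_set (@flower_rel n).
Proof.
apply/imsetP; exists ((letter t, i), (letter (twist t), (i + 1)%R)) => //.
by rewrite inE; case: t => [[]|] /=; rewrite eqxx.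
Qed.

Definition spoke i t : edge F := Sub (spoke_ends i t) (spoke_ends_edge i t).

Definition link i t : edge F := Sub (link_ends i t) (link_ends_edge i t).

Lemma mem_spoke v i t :
  (v \in ends (spoke i t)) = (v == (La, i)) || (v == (letter t, i)).
Proof. by rewrite !inE. Qed.

Lemma mem_link v i t : (v \in ends (link i t)) =
  (v == (letter t, i)) || (v == (letter (twist t), (i + 1)%R)).
Proof. by rewrite !inE. Qed.

Definition edge_of (k : 'Z_n * track * bool) : edge F :=
  let: (i, t, b) := k in if b then spoke i t else link i t.

(** Boolean equality, so that [xchoose] can pick a code for every edge. *)
Lemma edge_ofP e : exists k, e == edge_of k.
Proof.
case: e => E EP; have /imsetP[[[l i] [l' j]]] := EP.
rewrite inE /=; case: l l' => [] [] //= /eqP->{j} EE;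
  [exists (i, None, true) | exists (i, Some false, true)
  | exists (i, Some true, true) | exists (i, None, false)
  | exists (i, Some false, false) | exists (i, Some true, false)];
  by rewrite -val_eqE /= EE.
Qed.

Lemma letter_eq t u i j :
  ((letter t, i) == (letter u, j) :> flower_vertex n) = (t == u) && (i == j).
Proof. by rewrite xpair_eqE (inj_eq letter_inj). Qed.

Lemma letter_La t i j : ((letter t, i) == (La, j) :> flower_vertex n) = false.
Proof. by case: t => [[]|]. Qed.

Lemma La_letter t i j : ((La, j) == (letter t, i) :> flower_vertex n) = false.
Proof. by rewrite eq_sym letter_La. Qed.

Lemma spoke_neq_link i t j u : spoke i t != link j u.
Proof.
apply/eqP => E; have := mem_spoke (La, i) i t.
by rewrite E mem_link eqxx !La_letter.
Qed.

Lemma spoke_inj i : injective (spoke i).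
Proof.
move=> t u E; have := mem_spoke (letter t, i) i t.
rewrite E mem_spoke eqxx orbT letter_La letter_eq eqxx andbT.
by move/eqP.
Qed.

Definition hub_edges i : seq (edge F) :=
  [seq spoke i t | t <- [:: None; Some false; Some true]].

Definition leaf_edges i t : seq (edge F) :=
  [:: spoke i t; link i t; link (i - 1)%R (twist t)].

Lemma mem_hub_edges i e : ((La, i) \in ends e) = (e \in hub_edges i).
Proof.
have [[[j t] []] /eqP->] := edge_ofP e.
  rewrite mem_spoke La_letter orbF xpair_eqE /=.
  apply/eqP/mapP => [->|[u _ E]]; first by exists t => //; case: t => [[]|].
  apply/eqP; have := mem_spoke (La, j) j t.
  by rewrite E mem_spoke eqxx La_letter orbF xpair_eqE /= eq_sym.
rewrite mem_link !La_letter; apply/esym/negP => /mapP[u _ E].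
by have := spoke_neq_link i u j t; rewrite -E eqxx.
Qed.

Lemma uniq_hub_edges i : uniq (hub_edges i).
Proof. by rewrite map_inj_uniq //; apply: spoke_inj. Qed.

Lemma mem_leaf_edges i t e :
  ((letter t, i) \in ends e) = (e \in leaf_edges i t).
Proof.
apply/idP/idP.
  have [[[j u] []] /eqP->] := edge_ofP e.
    rewrite mem_spoke letter_La letter_eq => /andP[/eqP-> /eqP->].
    exact: mem_head.
  rewrite mem_link !letter_eq => /orP[] /andP[/eqP-> /eqP->].
    by rewrite !inE eqxx orbT.
  by rewrite /leaf_edges addrK twistK !inE eqxx !orbT.
rewrite !inE => /or3P[] /eqP->; rewrite ?mem_spoke ?mem_link ?twistK ?subrK;
  by rewrite eqxx ?orbT.
Qed.

Lemma uniq_leaf_edges i t : 2 < n -> uniq (leaf_edges i t).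
Proof.
move=> n2; rewrite /= !inE !negb_or !spoke_neq_link /= andbT.
have natr_neq0 k : 0 < k < n -> (k%:R != 0 :> 'Z_n)%R.
  move=> /andP[k0 kn]; rewrite -val_eqE /= val_Zp_nat ?modn_small -?lt0n //.
  by apply: leq_trans n2.
(* If the two links were equal, the far end of the first would lie on the second, forcing 2 = 0 or 1
   = 0 in Z/n. *)
apply/eqP => E; have := mem_link (letter (twist t), (i + 1)%R) i t.
rewrite E mem_link twistK subrK eqxx orbT !letter_eq eqxx /=.
rewrite -[X in X || _]subr_eq0 -[X in _ && X]subr_eq0 opprB (addrC (i + 1)%R).
rewrite addrA subrK addrAC subrr add0r (negbTE (natr_neq0 2 _)) //=.
by rewrite oner_eq0 andbF.
Qed.

(** * How a perfect matching runs through the stars *)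

Section Matching.
Hypotheses (n_gt2 : 2 < n) (n_odd : odd n).
Variable M : {set edge F}.
Hypothesis hM : perfect_matching M.

Lemma matching_hub i :
  (spoke i None \in M) + (spoke i (Some false) \in M)
   + (spoke i (Some true) \in M) = 1.
Proof.
rewrite -(hM (La, i)) -[RHS]/(#|[set e in mem M | (La, i) \in ends e]|).
rewrite (card_incident _ (uniq_hub_edges i) (mem_hub_edges i)) /=.
by rewrite addn0 addnA.
Qed.

Lemma matching_leaf i t :
  (spoke i t \in M) + (link i t \in M) + (link (i - 1)%R (twist t) \in M) = 1.
Proof.
rewrite -(hM (letter t, i)).
rewrite -[RHS]/(#|[set e in mem M | (letter t, i) \in ends e]|).
rewrite (card_incident _ (uniq_leaf_edges i t n_gt2) (mem_leaf_edges i t)) /=.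
by rewrite addn0 addnA.
Qed.

Definition links i : nat :=
  (link i None \in M) + (link i (Some false) \in M)
   + (link i (Some true) \in M).

(** The conditions at the three leaves of star [i + 1] add up to 3, of which its spokes account for
    1; [twist] only permutes the incoming tracks. *)
Lemma links_succ i : links (i + 1)%R + links i = 2.
Proof.
have := matching_hub (i + 1)%R; rewrite /links.
have := (matching_leaf (i + 1)%R None, matching_leaf (i + 1)%R (Some false),
  matching_leaf (i + 1)%R (Some true)).
by rewrite addrK /= => -[[]]; lia.
Qed.

Lemma links1 i : links i = 1.
Proof.
have n0 : (n%:R = 0 :> 'Z_n)%R.
  by apply: val_inj; rewrite /= val_Zp_nat ?modnn // ltnW.
have alt k : links (i + k%:R)%R = if odd k then 2 - links i else links i.
  elim: k => [|k IHk]; first by rewrite addr0.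
  have linksS j : links (j + 1)%R = 2 - links j.
    by rewrite -(links_succ j) addnK.
  rewrite mulrSr addrA linksS IHk /=; case: (odd k) => //=.
  by rewrite subKn // -(links_succ i) leq_addl.
(* Going once around the odd cycle gives [links i = 2 - links i]. *)
by have := alt n; rewrite n_odd n0 addr0; have := links_succ i; lia.
Qed.

(* The track of the matching edge leaving star [i] to the right. *)
Definition out_track i : track :=
  if link i None \in M then None else Some (link i (Some true) \in M).

Definition in_track i : track := twist (out_track (i - 1)%R).

Lemma link_matched i t : link i t \in M -> t = out_track i.
Proof.
have := links1 i; rewrite /links /out_track.
by case: t => [[]|] + H; rewrite H; case: (_ \in M); case: (_ \in M).
Qed.

Lemma link_out_track i : link i (out_track i) \in M.
Proof.
have := links1 i; rewrite /links /out_track.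
case: ifP => //= _; case E: (link i (Some true) \in M) => //=.
by case: (link i (Some false) \in M).
Qed.

Lemma link_in_track i : link (i - 1)%R (twist (in_track i)) \in M.
Proof. by rewrite /in_track twistK link_out_track. Qed.

(** Otherwise the leaf on that track would lie on two matching edges. *)
Lemma out_track_neq_in i : out_track i != in_track i.
Proof.
apply/eqP => E; have := matching_leaf i (out_track i).
by rewrite link_out_track {2}E link_in_track; case: (_ \in M).
Qed.

Lemma spoke_matched i t :
  spoke i t \in M -> (t != in_track i) && (t != out_track i).
Proof.
move=> tM; have := matching_leaf i t; rewrite tM.
apply: contra_eqT; rewrite negb_and !negbK => /orP[] /eqP->.
  by rewrite link_in_track; case: (_ \in M).
by rewrite link_out_track; case: (_ \in M).
Qed.

(** The right links of a star are the left links of the next, so adjacent edges always meet at a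
    vertex of one star, whose conditions apply. *)
Lemma flower_colorable k (L S : 'Z_n -> track -> 'I_k * 'I_k) :
  (forall i, star_coloring (in_track i) (out_track i) (L i) (S i)
     (fun t => L (i + 1)%R (twist t))) ->
  edge_colorable (add_parallel M) k.
Proof.
move=> LS; pose Q (x : 'Z_n * track * bool) :=
  let: (i, t, b) := x in if b then S i t else L (i + 1)%R (twist t).
have through i t : disjoint_pairs (L i t) (L (i + 1)%R (twist t)).
  exact: star_through (LS i) t.
have left i t : disjoint_pairs (L i t) (S i t) by apply: star_left (LS i) t.
have right i t : disjoint_pairs (S i t) (L (i + 1)%R (twist t)).
  exact: star_right (LS i) t.
apply: (@add_parallel_colorable _ M k (fun e => Q (xchoose (edge_ofP e)))).
  move=> e; rewrite {1}(eqP (xchooseP (edge_ofP e))).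
  case: (xchoose _) => [[i t] []] /= tM.
    by have /andP[] := spoke_matched tM; apply: star_match (LS i) t.
  by rewrite (link_matched tM); apply: star_link (LS i).
move=> e f; rewrite {1 2}(eqP (xchooseP (edge_ofP e))).
rewrite {1 2}(eqP (xchooseP (edge_ofP f))).
move: (xchoose (edge_ofP e)) (xchoose (edge_ofP f)) => [[i t] b] [[j u] b'] ef.
case/set0Pn=> v.
rewrite inE => /andP[]; case: b b' ef => [] [] ef;
  rewrite ?mem_spoke ?mem_link => /orP[] /eqP-> /orP[];
  rewrite ?letter_La ?La_letter ?letter_eq ?xpair_eqE //=.
- move=> /eqP ij; move: ef; rewrite ij => ef; apply: (star_center (LS j)).
  by apply: contraNneq ef => ->.
- by move=> /andP[/eqP tu /eqP ij]; rewrite /= tu ij eqxx in ef.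
- by move=> /andP[/eqP-> /eqP->].
- by move=> /andP[/eqP-> /eqP->]; rewrite disjoint_pairsC.
- by move=> /andP[/eqP<- /eqP<-]; rewrite disjoint_pairsC.
- by move=> /andP[/eqP<- /eqP<-].
- by move=> /andP[/eqP tu /eqP ij]; rewrite /= tu ij eqxx in ef.
- by move=> /andP[/eqP-> /eqP->]; rewrite disjoint_pairsC.
- by move=> /andP[/eqP<- /eqP<-].
(* Two links entering the same leaf coincide, as [twist] and adding 1 are injective. *)
- move=> /andP[/eqP/(can_inj twistK) tu /eqP/addIr ij].
  by rewrite /= tu ij eqxx in ef.
Qed.

Lemma flower_4_colorable : 5 <= n -> edge_colorable (add_parallel M) 4.
Proof.
move=> n5.
pose turn m := out_track (m.+1%:R)%R == twist (in_track (m%:R)%R).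
have q0 : all_distinct state0 by [].
(* A closed walk: after [n] moves the state is [state0] again. *)
have [f [f0 fn fS]] := walk_exists turn n5 q0 q0.
have n1 : 1 < n by apply: leq_trans n5.
have fP m : m <= n -> all_distinct (f m).
  elim: m => [|m IHm] mn; first by rewrite f0.
  by apply: all_distinct_moves (fS _ mn) _; apply/IHm/ltnW.
pose q (i : 'Z_n) := f i.
pose L i := link_pairs (in_track i) (out_track i) (q i).
have lt_n (i : 'Z_n) : i < n by rewrite -[X in _ < X](Zp_cast n1) ltn_ord.
have step i : q (i + 1)%R \in
    moves (out_track (i + 1)%R == twist (in_track i)) (q i).
  have := fS _ (lt_n i); rewrite /turn mulrSr !natr_Zp.
  suff -> : f (val i).+1 = q (i + 1)%R by [].
  have -> : q (i + 1)%R = f (i.+1 %% n).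
    by rewrite /q /= modnDmr addn1; congr (f (_ %% _)); apply: Zp_cast.
  have [in1|] := ltnP i.+1 n; first by rewrite modn_small.
  (* After the last star the index wraps to 0, and [f n = f 0] closes the colouring. *)
  rewrite leq_eqVlt ltnNge lt_n orbF => /eqP <-.
  by rewrite modnn fn f0.
(* The states fix all links, so the spokes of each star can be chosen independently. *)
have /fin_all_exists[S LS] : forall i, exists Si, star_coloring (in_track i)
    (out_track i) (L i) Si (fun t => L (i + 1)%R (twist t)).
  move=> i; have := out_track_neq_in (i + 1)%R.
  have inS : in_track (i + 1)%R = twist (out_track i).
    by rewrite /in_track addrK.
  rewrite /L inS => out_neq.
  apply: star_extension => //; first exact/fP/ltnW.
    exact: out_track_neq_in.
exact: flower_colorable LS.
Qed.

End Matching.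
End FlowerSnark.

Theorem theorem4p4 (n : nat) (hn : 5 <= n) (hodd : odd n)
    (M : {set edge (flower_snark n)}) (hM : perfect_matching M) :
  classI (add_parallel M).
Proof.
have n2 : 2 < n by apply: leq_trans hn.
(* The centre of star 0 has degree 3 + 1 = 4 in G + M. *)
apply: (@classI_of_colorable (add_parallel M) 4 (La, 0%R)).
  exact: flower_4_colorable.
rewrite (degree_add_parallel _ hM).
by rewrite (degreeE (uniq_hub_edges _) (mem_hub_edges _)).
Qed.
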